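(* Let $\phi_1,\dots,\phi_n,\psi$ be dGL formulas such that the inference with premises $\phi_1,\dots,\phi_n$ and conclusion $\psi$ is locally sound. Let $\sigma$ be a uniform substitution such that $\sigma^{\mathcal V}(\phi_1),\dots,\sigma^{\mathcal V}(\phi_n)$ and $\sigma^{\mathcal V}(\psi)$ are all defined. Then the inference with premises $\sigma^{\mathcal V}(\phi_1),\dots,\sigma^{\mathcal V}(\phi_n)$ and conclusion $\sigma^{\mathcal V}(\psi)$ is locally sound.
   Context: Differential game logic (dGL). Fix a finite set $\mathcal V$ of variables that contains, for each variable $x$, a distinct differential variable $x'$ (no higher-order differentials). Function symbols $f$ and predicate symbols $p$ have arity $0$ or $1$; there is a reserved function symbol $\cdot$ of arity $0$; and there are game symbols $a$. Terms: $\theta,\eta::=x\mid f\mid f(\theta)\mid\theta+\eta\mid\theta\cdot\eta\mid(\theta)'$. Formulas: $\phi,\psi::=\theta\ge\eta\mid p\mid p(\theta)\mid\neg\phi\mid\phi\wedge\psi\mid\exists x\,\phi\mid\langle\alpha\rangle\phi$. Hybrid games: $\alpha,\beta::=a\mid x:=\theta\mid x'=\theta\,\&\,\psi\mid ?\psi\mid\alpha\cup\beta\mid\alpha;\beta\mid\alpha^*\mid\alpha^d$. In $x'=\theta\&\psi$, $x$ may be a vector of distinct variables and $\theta$ a matching vector of terms; then $\{x,x'\}$ denotes all these variables and their differential variables. Semantics. A state is a map $\omega:\mathcal V\to\mathbb R$, and $\mathcal S$ is the set of all states. An interpretation $I$ assigns to each function symbol a real number (arity 0) or a smooth function $\mathbb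 R\to\mathbb R$ (arity 1); to each predicate symbol a truth value (arity 0) or a subset of $\mathbb R$ (arity 1); and to each game symbol $a$ a monotone map $I(a):\mathcal P(\mathcal S)\to\mathcal P(\mathcal S)$. The value $I\omega[\![\theta]\!]$ is defined by: - $I\omega[\![x]\!]=\omega(x)$; - $I\omega[\![f(\theta)]\!]=I(f)(I\omega[\![\theta]\!])$; - sums and products are evaluated pointwise; - $I\omega[\![(\theta)']\!]=\sum_{x\in\mathcal V}\omega(x')\frac{\partial I\omega[\![\theta]\!]}{\partial x}$. Formulas denote sets $I[\![\phi]\!]\subseteq\mathcal S$ with the usual clauses for $\ge,p,\neg,\wedge$. A state is in $I[\![\exists x\phi]\!]$ iff some modification of its value of $x$ is in $I[\![\phi]\!]$. Finally $I[\![\langle\alpha\rangle\phi]\!]=\varsigma^I_\alpha(I[\![\phi]\!])$, where the winning region $\varsigma^I_\alpha(X)$ for $X\subseteq\mathcal S$ is: - $\varsigma^I_a(X)=I(a)(X)$; - $\varsigma^I_{x:=\theta}(X)=\{\omega:\omega[x\mapsto I\omega[\![\theta]\!]]\in X\}$; - $\varsigma^I_{x'=\theta\&\psi}(X)$ is the set of $\omega$ for which there are $r\ge0$ and $\varphi:[0,r]\to\mathcal S$ with: $\varphi(0)=\omega$ except on $x'$; $\varphi(r)\in X$; and for all $\zeta\in[0,r]$, $\varphi(\zeta)\in I[\![\psi]\!]$, $\varphi(\zeta)(x')=I\varphi(\zeta)[\![\theta]\!]$, $\varphi(\zeta)=\varphi(0)$ except on $\{x,x'\}$, and, if $r>0$,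 $\frac{d\varphi(t)(x)}{dt}(\zeta)$ exists and equals $\varphi(\zeta)(x')$; - $\varsigma^I_{?\psi}(X)=I[\![\psi]\!]\cap X$; - $\varsigma^I_{\alpha\cup\beta}(X)=\varsigma^I_\alpha(X)\cup\varsigma^I_\beta(X)$; - $\varsigma^I_{\alpha;\beta}(X)=\varsigma^I_\alpha(\varsigma^I_\beta(X))$; - $\varsigma^I_{\alpha^*}(X)=\bigcap\{Z: X\cup\varsigma^I_\alpha(Z)\subseteq Z\}$; - $\varsigma^I_{\alpha^d}(X)=\mathcal S\setminus\varsigma^I_\alpha(\mathcal S\setminus X)$. A formula $\phi$ is valid in $I$ iff $I[\![\phi]\!]=\mathcal S$. An inference with premises $\phi_1,\dots,\phi_n$ and conclusion $\psi$ is locally sound iff for every interpretation $I$ in which all $\phi_j$ are valid, $\psi$ is valid in $I$. Static semantics. $BV(\alpha)$ is the set of $x$ for which there exist $I,\omega,X$ with $\omega\in\varsigma^I_\alpha(X)$ but $\omega\notin\varsigma^I_\alpha(\{\nu\in X:\nu(x)=\omega(x)\})$. $FV(\theta)$ (resp. $FV(\phi)$) is the set of $x$ for which there are $I$ and states agreeing except on $x$ that give $\theta$ different values (resp. differ in membership in $I[\![\phi]\!]$). One-pass uniform substitution. A uniform substitution $\sigma$ maps finitely many function symbols to terms $\sigma f(\cdot)$ (arity 1; may mention the placeholder $\cdot$) or $\sigma f$ (arity 0), predicate symbols to formulas $\sigma p(\cdot)$ or $\sigma p$, and game symbols to games $\sigma a$. Other symbols are mapped to themselves. For $U\subseteq\mathcal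 V$, $\sigma^U(\theta)$, $\sigma^U(\phi)$, and games $\sigma^U_V(\alpha)$ with output taboo set $V$ are defined recursively as follows; the result is undefined if a side condition fails or a recursive call is undefined. Terms: - $\sigma^U(x)=x$; - $\sigma^U(f)=\sigma f$ if $FV(\sigma f)\cap U=\emptyset$; - $\sigma^U(f(\theta))=\{\cdot\mapsto\sigma^U(\theta)\}^{\emptyset}(\sigma f(\cdot))$ if $FV(\sigma f(\cdot))\cap U=\emptyset$; - $+$ and $\cdot$ are homomorphic; - $\sigma^U((\theta)')=(\sigma^{\mathcal V}(\theta))'$. Formulas: - $\sigma^U(\theta\ge\eta)=\sigma^U(\theta)\ge\sigma^U(\eta)$; - $\sigma^U(p)=\sigma p$ if $FV(\sigma p)\cap U=\emptyset$; - $\sigma^U(p(\theta))=\{\cdot\mapsto\sigma^U(\theta)\}^{\emptyset}(\sigma p(\cdot))$ if $FV(\sigma p(\cdot))\cap U=\emptyset$; - $\neg,\wedge$ are homomorphic; - $\sigma^U(\exists x\phi)=\exists x\,\sigma^{U\cup\{x\}}(\phi)$; - $\sigma^U(\langle\alpha\rangle\phi)=\langle\sigma^U_V(\alpha)\rangle\sigma^V(\phi)$. Games: - $\sigma^U_{U\cup BV(\sigma a)}(a)=\sigma a$; - $\sigma^U_{U\cup\{x\}}(x:=\theta)=(x:=\sigma^U(\theta))$; - $\sigma^U_{U\cup\{x,x'\}}(x'=\theta\&\psi)=(x'=\sigma^{U\cup\{x,x'\}}(\theta)\&\sigma^{U\cup\{x,x'\}}(\psi))$; - $\sigma^U_U(?\psi)=?\sigma^U(\psi)$;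 - $\sigma^U_{V\cup W}(\alpha\cup\beta)=\sigma^U_V(\alpha)\cup\sigma^U_W(\beta)$; - $\sigma^U_W(\alpha;\beta)=\sigma^U_V(\alpha);\sigma^V_W(\beta)$; - $\sigma^U_V(\alpha^* )=(\sigma^V_V(\alpha))^*$, where $\sigma^U_V(\alpha)$ must be defined; - $\sigma^U_V(\alpha^d)=(\sigma^U_V(\alpha))^d$. *)

(* Defs.v *)
From mathcomp Require Import all_boot all_order all_algebra finmap.
From mathcomp Require Import all_classical all_reals all_analysis.

Set Implicit Arguments.
Unset Strict Implicit.
Unset Printing Implicit Defensive.

Import Order.TTheory GRing.Theory Num.Theory.
Import numFieldNormedType.Exports.

Local Open Scope classical_set_scope.
Local Open Scope ring_scope.

(* Function and predicate symbols are split by arity (0 or 1). *)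
Record signature := Signature {
  fun0 : choiceType;
  dot : fun0;
  fun1 : choiceType;
  pred0 : choiceType;
  pred1 : choiceType;
  gsym : choiceType
}.

(* B is the finite set of variables that are not differential variables. The
   set of all variables is B + B: inl x is the variable x and inr x is its
   differential variable x'. *)
Notation var B := (B + B)%type.

Inductive trm (B : finType) (S : signature) : Type :=
| TVar of var B
| TFun0 of fun0 S
| TFun1 of fun1 S & trm B S
| TAdd of trm B S & trm B S
| TMul of trm B S & trm B S
| TDiff of trm B S.

Arguments TVar {B S} _.
Arguments TFun0 {B S} _.

(* GOde x injx th psi is the system x' = th & psi for the vector x of n+1
   variables, which injx makes pairwise distinct. *)
Inductive fml (B : finType) (S : signature) : Type :=
| FGe of trm B S & trm B S
| FPred0 of pred0 S
| FPred1 of pred1 S & trm B S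
| FNot of fml B S
| FAnd of fml B S & fml B S
| FEx of var B & fml B S
| FDia of game B S & fml B S
with game (B : finType) (S : signature) : Type :=
| GSym of gsym S
| GAssign of var B & trm B S
| GOde (n : nat) (x : 'I_n.+1 -> B) of injective x & 'I_n.+1 -> trm B S
    & fml B S
| GTest of fml B S
| GChoice of game B S & game B S
| GSeq of game B S & game B S
| GStar of game B S
| GDual of game B S.

Arguments FPred0 {B S} _.
Arguments GSym {B S} _.

Definition state (R : realType) (B : finType) := var B -> R.

Definition upd (R : realType) (B : finType) (w : state R B) (x : var B) (v : R)
  : state R B := fun y => if y == x then v else w y.

Definition smooth (R : realType) (f : R -> R) :=
  forall (n : nat) (x : R), derivable (derive1n n f) x 1.

Record interp (R : realType) (B : finType) (S : signature) := Interp {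
  ifun0 : fun0 S -> R;
  ifun1 : fun1 S -> R -> R;
  ifun1_smooth : forall f, smooth (ifun1 f);
  ipred0 : pred0 S -> Prop;
  ipred1 : pred1 S -> set R;
  igame : gsym S -> set (state R B) -> set (state R B);
  igame_mono : forall a (X Y : set (state R B)),
    X `<=` Y -> igame a X `<=` igame a Y
}.

(* In TDiff only the variables in B have a differential variable, so the sum
   over all variables is a sum over B. *)
Fixpoint tval (R : realType) (B : finType) (S : signature) (I : interp R B S)
    (w : state R B) (th : trm B S) {struct th} : R :=
  match th with
  | TVar x => w x
  | TFun0 f => ifun0 I f
  | TFun1 f t => ifun1 I f (tval I w t)
  | TAdd t u => tval I w t + tval I w u
  | TMul t u => tval I w t * tval I w u
  | TDiff t => \sum_(x : B)
      w (inr x) * derive1 (fun s : R => tval I (upd w (inl x) s) t) (w (inl x))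
  end.

(* The derivative at z of f restricted to A; one-sided at the endpoints when A
   is a closed interval. *)
Definition has_derivative_within (R : realType) (A : set R) (f : R -> R)
    (z l : R) :=
  (fun t : R => (f t - f z) / (t - z)) @ within A z^' --> l.

Definition ode_vars (B : finType) (n : nat) (x : 'I_n.+1 -> B) : set (var B) :=
  [set y | exists i, y = inl (x i) \/ y = inr (x i)].

(* The flow is a total function of time, but only its values on [0, r] are
   used. *)
Definition ode_region (R : realType) (B : finType) (n : nat)
    (x : 'I_n.+1 -> B) (th : 'I_n.+1 -> state R B -> R)
    (dom X : set (state R B)) : set (state R B) :=
  [set w | exists (r : R) (flow : R -> state R B),
    [/\ 0 <= r,
        forall y, (forall i, y <> inr (x i)) -> flow 0 y = w y,
        X (flow r)
      & forall z : R, 0 <= z <= r ->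
        [/\ dom (flow z),
            forall i, flow z (inr (x i)) = th i (flow z),
            forall y, ~ ode_vars x y -> flow z y = flow 0 y
          & 0 < r -> forall i,
              has_derivative_within `[0, r] (fun t => flow t (inl (x i))) z
                (flow z (inr (x i)))]]].

Fixpoint fsem (R : realType) (B : finType) (S : signature) (I : interp R B S)
    (phi : fml B S) {struct phi} : set (state R B) :=
  match phi with
  | FGe t u => [set w | tval I w u <= tval I w t]
  | FPred0 p => [set w | ipred0 I p]
  | FPred1 p t => [set w | ipred1 I p (tval I w t)]
  | FNot f => ~` fsem I f
  | FAnd f g => fsem I f `&` fsem I g
  | FEx x f => [set w | exists v : R, fsem I f (upd w x v)]
  | FDia a f => gsem I a (fsem I f)
  end
with gsem (R : realType) (B : finType) (S : signature) (I : interp R B S)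
    (al : game B S) {struct al} : set (state R B) -> set (state R B) :=
  match al with
  | GSym a => igame I a
  | GAssign x t => fun X => [set w | X (upd w x (tval I w t))]
  | GOde n x _ th psi =>
      ode_region x (fun i w => tval I w (th i)) (fsem I psi)
  | GTest f => fun X => fsem I f `&` X
  | GChoice a b => fun X => gsem I a X `|` gsem I b X
  | GSeq a b => fun X => gsem I a (gsem I b X)
  | GStar a => fun X => \bigcap_(Z in [set Z | X `|` gsem I a Z `<=` Z]) Z
  | GDual a => fun X => ~` gsem I a (~` X)
  end.

Definition valid_in (R : realType) (B : finType) (S : signature)
    (I : interp R B S) (phi : fml B S) := fsem I phi = setT.

Definition locally_sound (R : realType) (B : finType) (S : signature) (n : nat)
    (phi : 'I_n -> fml B S) (psi : fml B S) :=
  forall I : interp R B S,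
    (forall j, valid_in I (phi j)) -> valid_in I psi.

Definition BV (R : realType) (B : finType) (S : signature) (al : game B S)
  : set (var B) :=
  [set x | exists (I : interp R B S) (w : state R B) (X : set (state R B)),
    gsem I al X w /\ ~ gsem I al (X `&` [set v | v x = w x]) w].

Definition agree_except (R : realType) (B : finType) (x : var B)
    (w v : state R B) := forall y, y <> x -> w y = v y.

Definition FVt (R : realType) (B : finType) (S : signature) (th : trm B S)
  : set (var B) :=
  [set x | exists (I : interp R B S) (w v : state R B),
    agree_except x w v /\ tval I w th <> tval I v th].

Definition FVf (R : realType) (B : finType) (S : signature) (phi : fml B S)
  : set (var B) :=
  [set x | exists (I : interp R B S) (w v : state R B),
    [/\ agree_except x w v, fsem I phi w & ~ fsem I phi v]].

Local Open Scope fmap_scope.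

(* Replacements of arity-1 symbols mention their argument as TFun0 (dot S). *)
Record usubst (B : finType) (S : signature) := USubst {
  sfun0 : {fmap fun0 S -> trm B S};
  sfun1 : {fmap fun1 S -> trm B S};
  spred0 : {fmap pred0 S -> fml B S};
  spred1 : {fmap pred1 S -> fml B S};
  sgame : {fmap gsym S -> game B S}
}.

Definition apply_fun0 (B : finType) (S : signature) (s : usubst B S)
    (f : fun0 S) : trm B S := odflt (TFun0 f) ((sfun0 s).[? f]).

Definition apply_pred0 (B : finType) (S : signature) (s : usubst B S)
    (p : pred0 S) : fml B S := odflt (FPred0 p) ((spred0 s).[? p]).

Definition apply_game (B : finType) (S : signature) (s : usubst B S)
    (a : gsym S) : game B S := odflt (GSym a) ((sgame s).[? a]).

Definition dot_subst (B : finType) (S : signature) (t : trm B S) : usubst B S :=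
  USubst ([fmap].[dot S <- t]) [fmap] [fmap] [fmap] [fmap].

(* The graph of the partial function: usubst_trm R s U th th' means that
   s^U(th) is defined and equal to th'. An arity-1 symbol f outside the domain
   of s satisfies s^U(f(th)) = f(s^U(th)); the clause for replaced symbols with
   f(dot) as replacement would call itself forever. *)
Inductive usubst_trm (R : realType) (B : finType) (S : signature)
  : usubst B S -> set (var B) -> trm B S -> trm B S -> Prop :=
| USVar s U x : usubst_trm R s U (TVar x) (TVar x)
| USFun0 s U f :
    FVt R (apply_fun0 s f) `&` U = set0 ->
    usubst_trm R s U (TFun0 f) (apply_fun0 s f)
| USFun1 s U f t t' rep res :
    (sfun1 s).[? f] = Some rep ->
    FVt R rep `&` U = set0 ->
    usubst_trm R s U t t' ->
    usubst_trm R (dot_subst t') set0 rep res ->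
    usubst_trm R s U (TFun1 f t) res
| USFun1_id s U f t t' :
    (sfun1 s).[? f] = None ->
    usubst_trm R s U t t' ->
    usubst_trm R s U (TFun1 f t) (TFun1 f t')
| USAdd s U t t' u u' :
    usubst_trm R s U t t' -> usubst_trm R s U u u' ->
    usubst_trm R s U (TAdd t u) (TAdd t' u')
| USMul s U t t' u u' :
    usubst_trm R s U t t' -> usubst_trm R s U u u' ->
    usubst_trm R s U (TMul t u) (TMul t' u')
| USDiff s U t t' :
    usubst_trm R s setT t t' ->
    usubst_trm R s U (TDiff t) (TDiff t').

(* usubst_game R s U V al al' means that s^U_V(al) is defined and equal to al',
   where V is the output taboo set. *)
Inductive usubst_fml (R : realType) (B : finType) (S : signature)
  : usubst B S -> set (var B) -> fml B S -> fml B S -> Prop :=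
| USGe s U t t' u u' :
    usubst_trm R s U t t' -> usubst_trm R s U u u' ->
    usubst_fml R s U (FGe t u) (FGe t' u')
| USPred0 s U p :
    FVf R (apply_pred0 s p) `&` U = set0 ->
    usubst_fml R s U (FPred0 p) (apply_pred0 s p)
| USPred1 s U p t t' rep res :
    (spred1 s).[? p] = Some rep ->
    FVf R rep `&` U = set0 ->
    usubst_trm R s U t t' ->
    usubst_fml R (dot_subst t') set0 rep res ->
    usubst_fml R s U (FPred1 p t) res
| USPred1_id s U p t t' :
    (spred1 s).[? p] = None ->
    usubst_trm R s U t t' ->
    usubst_fml R s U (FPred1 p t) (FPred1 p t')
| USNot s U f f' :
    usubst_fml R s U f f' ->
    usubst_fml R s U (FNot f) (FNot f')
| USAnd s U f f' g g' :
    usubst_fml R s U f f' -> usubst_fml R s U g g' ->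
    usubst_fml R s U (FAnd f g) (FAnd f' g')
| USEx s U x f f' :
    usubst_fml R s (U `|` [set x]) f f' ->
    usubst_fml R s U (FEx x f) (FEx x f')
| USDia s U V a a' f f' :
    usubst_game R s U V a a' -> usubst_fml R s V f f' ->
    usubst_fml R s U (FDia a f) (FDia a' f')
with usubst_game (R : realType) (B : finType) (S : signature)
  : usubst B S -> set (var B) -> set (var B) -> game B S -> game B S -> Prop :=
| USSym s U a :
    usubst_game R s U (U `|` BV R (apply_game s a)) (GSym a) (apply_game s a)
| USAssign s U x t t' :
    usubst_trm R s U t t' ->
    usubst_game R s U (U `|` [set x]) (GAssign x t) (GAssign x t')
| USOde s U n (x : 'I_n.+1 -> B) (injx : injective x) th th' psi psi' :
    (forall i, usubst_trm R s (U `|` ode_vars x) (th i) (th' i)) ->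
    usubst_fml R s (U `|` ode_vars x) psi psi' ->
    usubst_game R s U (U `|` ode_vars x)
      (GOde injx th psi) (GOde injx th' psi')
| USTest s U f f' :
    usubst_fml R s U f f' ->
    usubst_game R s U U (GTest f) (GTest f')
| USChoice s U V W a a' b b' :
    usubst_game R s U V a a' -> usubst_game R s U W b b' ->
    usubst_game R s U (V `|` W) (GChoice a b) (GChoice a' b')
| USSeq s U V W a a' b b' :
    usubst_game R s U V a a' -> usubst_game R s V W b b' ->
    usubst_game R s U W (GSeq a b) (GSeq a' b')
| USStar s U V a a1 a' :
    usubst_game R s U V a a1 -> usubst_game R s V V a a' ->
    usubst_game R s U V (GStar a) (GStar a')
| USDual s U V a a' :
    usubst_game R s U V a a' ->
    usubst_game R s U V (GDual a) (GDual a').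

Scheme usubst_fml_game_ind := Induction for usubst_fml Sort Prop
with usubst_game_fml_ind := Induction for usubst_game Sort Prop.

Lemma usubst_trm_functional (R : realType) (B : finType) (S : signature)
    (s : usubst B S) (U : set (var B)) (t t1 t2 : trm B S) :
  usubst_trm R s U t t1 -> usubst_trm R s U t t2 -> t1 = t2.
Proof.
move=> h; elim: h t2 => {s U t t1}.
- by move=> s U x t2 h; inversion h.
- by move=> s U f _ t2 h; inversion h.
- move=> s U f t t' rep res e _ _ IH1 _ IH2 t2 h; inversion h; subst.
    have e1 := IH1 _ ltac:(eassumption).
    by apply: IH2; congruence.
  by congruence.
- move=> s U f t t' e _ IH t2 h; inversion h; subst; first by congruence.
  by rewrite (IH _ ltac:(eassumption)).
- move=> s U t t' u u' _ IH1 _ IH2 t2 h; inversion h; subst.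
  by rewrite (IH1 _ ltac:(eassumption)) (IH2 _ ltac:(eassumption)).
- move=> s U t t' u u' _ IH1 _ IH2 t2 h; inversion h; subst.
  by rewrite (IH1 _ ltac:(eassumption)) (IH2 _ ltac:(eassumption)).
- move=> s U t t' _ IH t2 h; inversion h; subst.
  by rewrite (IH _ ltac:(eassumption)).
Qed.

Lemma usubst_fml_functional (R : realType) (B : finType) (S : signature)
    (s : usubst B S) (U : set (var B)) (f f1 f2 : fml B S) :
  usubst_fml R s U f f1 -> usubst_fml R s U f f2 -> f1 = f2.
Proof.
move=> h; move: h f2.
apply: (@usubst_fml_game_ind R B S
  (fun s U f f1 _ => forall f2, usubst_fml R s U f f2 -> f1 = f2)
  (fun s U V a a1 _ => forall V2 a2, usubst_game R s U V2 a a2 ->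
     V = V2 /\ a1 = a2)) => {s U f f1}.
- move=> s U t t' u u' h1 h2 f2 h; inversion h; subst.
  by rewrite (usubst_trm_functional h1 ltac:(eassumption)) (usubst_trm_functional h2 ltac:(eassumption)).
- by move=> s U p _ f2 h; inversion h.
- move=> s U p t t' rep res e _ h1 _ IH f2 h; inversion h; subst.
    have e1 := usubst_trm_functional h1 ltac:(eassumption).
    by apply: IH; congruence.
  by congruence.
- move=> s U p t t' e h1 f2 h; inversion h; subst; first by congruence.
  by rewrite (usubst_trm_functional h1 ltac:(eassumption)).
- by move=> s U f f' _ IH f2 h; inversion h; subst; rewrite (IH _ ltac:(eassumption)).
- move=> s U f f' g g' _ IH1 _ IH2 f2 h; inversion h; subst.
  by rewrite (IH1 _ ltac:(eassumption)) (IH2 _ ltac:(eassumption)).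
- by move=> s U x f f' _ IH f2 h; inversion h; subst; rewrite (IH _ ltac:(eassumption)).
- move=> s U V a a' f f' _ IH1 _ IH2 f2 h; inversion h; subst.
  have [eV ea] := IH1 _ _ ltac:(eassumption); subst.
  by rewrite (IH2 _ ltac:(eassumption)).
- by move=> s U a V2 a2 h; inversion h.
- move=> s U x t t' h1 V2 a2 h; inversion h; subst.
  by rewrite (usubst_trm_functional h1 ltac:(eassumption)).
- move=> s U n x injx th th' psi psi' h1 _ IH V2 a2 h; inversion h; subst.
  repeat match goal with
  | e : existT _ _ _ = existT _ _ _ |- _ => apply (@eq_from_Tagged nat) in e
  end; subst.
  have -> : th' = th'0.
    by apply/funext => i; apply: (usubst_trm_functional (h1 i)).
  rewrite (IH _ ltac:(eassumption)); split=> //; congr GOde.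
  exact: Prop_irrelevance.
- by move=> s U f f' _ IH V2 a2 h; inversion h; subst;
  rewrite (IH _ ltac:(eassumption)).
- move=> s U V W a a' b b' _ IH1 _ IH2 V2 a2 h; inversion h; subst.
  have [-> ->] := IH1 _ _ ltac:(eassumption).
  by have [-> ->] := IH2 _ _ ltac:(eassumption).
- move=> s U V W a a' b b' _ IH1 _ IH2 V2 a2 h; inversion h; subst.
  have [eV ea] := IH1 _ _ ltac:(eassumption); subst.
  by have [-> ->] := IH2 _ _ ltac:(eassumption).
- move=> s U V a a1 a' _ IH1 _ IH2 V2 a2 h; inversion h; subst.
  have [eV ea] := IH1 _ _ ltac:(eassumption); subst.
  by have [_ ->] := IH2 _ _ ltac:(eassumption).
- move=> s U V a a' _ IH V2 a2 h; inversion h; subst.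
  by have [-> ->] := IH _ _ ltac:(eassumption).
Qed.

(* Main.v *)
Require Import Defs.
From mathcomp Require Import all_boot all_order all_algebra finmap.
From mathcomp Require Import all_classical all_reals all_analysis.
(* MathComp also has a [tval], a [pred0] and a [pred1]. *)
Import Defs.

(** The substitution is absorbed into the interpretation: for a state [w], the
    adjoint interpretation reads every symbol as the meaning of its replacement
    in [w]. Substituted syntax read in [I] and original syntax read in the
    adjoint agree on all states that differ from [w] only on the taboo set,
    because the side conditions forbid replacements to depend on taboo
    variables and the output taboo of a game contains what the game can change.
    With taboo set [setT] the base state [w] is immaterial, so validity of whole
    formulas in [I] is validity in one adjoint interpretation, to which local
    soundness applies.

    The adjoint reading of a unary function symbol must be smooth although the
    replacement may contain differentials. Term values lie in the class of
    functions generated from projections and constants by sums, products and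
    composition with smooth unary functions; it is closed under partial
    derivatives by the one-dimensional chain rule, so no multivariate calculus
    is involved. *)

Set Implicit Arguments.
Unset Strict Implicit.
Unset Printing Implicit Defensive.

Import Order.TTheory GRing.Theory Num.Theory.
Import numFieldNormedType.Exports.

Local Open Scope classical_set_scope.
Local Open Scope ring_scope.

(** * Smoothness of term values *)

Lemma smooth_derive1 (R : realType) (f : R -> R) :
  smooth f -> smooth (derive1 f).
Proof. by move=> sf n x; rewrite -derive1Sn; apply: sf. Qed.

Section ElementaryFunctions.
Variables (R : realType) (V : eqType).
Implicit Types (e : V -> R) (F G : (V -> R) -> R).

Definition set_coord e (x : V) (s : R) : V -> R :=
  fun y => if y == x then s else e y.

Inductive elementary : ((V -> R) -> R) -> Prop :=
| elementary_proj x : elementary (fun e => e x)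
| elementary_const c : elementary (fun=> c)
| elementary_comp f F :
    smooth f -> elementary F -> elementary (fun e => f (F e))
| elementary_add F G :
    elementary F -> elementary G -> elementary (fun e => F e + G e)
| elementary_mul F G :
    elementary F -> elementary G -> elementary (fun e => F e * G e).

Lemma set_coord_id e x : set_coord e x (e x) = e.
Proof. by apply/funext => y; rewrite /set_coord; case: eqP => [->|]. Qed.

Lemma set_coord_twice e x s t :
  set_coord (set_coord e x s) x t = set_coord e x t.
Proof. by apply/funext => y; rewrite /set_coord; case: eqP. Qed.

Lemma elementary_sum (I : Type) (r : seq I) (F : I -> (V -> R) -> R) :
  (forall i, elementary (F i)) -> elementary (fun e => \sum_(i <- r) F i e).
Proof.
move=> eF; elim: r => [|i r IH].
  rewrite (_ : (fun e => _) = fun=> 0); first exact: elementary_const.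
  by apply/funext => e; rewrite big_nil.
rewrite (_ : (fun e => _) = fun e => F i e + \sum_(j <- r) F j e).
  exact: elementary_add.
by apply/funext => e; rewrite big_cons.
Qed.

(** One elementary [G] serves all points [e], so partial derivatives can be iterated. *)
Lemma elementary_partial F (x : V) : elementary F ->
  exists2 G, elementary G &
    forall e, is_derive (e x) 1 (fun s => F (set_coord e x s)) (G e).
Proof.
elim=> {F} [y|c|f F sf eF [G eG dF]|F1 F2 eF1 [G1 eG1 d1] eF2 [G2 eG2 d2]
           |F1 F2 eF1 [G1 eG1 d1] eF2 [G2 eG2 d2]].
- have [->|yx] := eqVneq y x.
    exists (fun=> 1) => [|e]; first exact: elementary_const.
    rewrite (_ : (fun s => _) = id); first exact: is_derive_id.
    by apply/funext => s; rewrite /set_coord eqxx.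
  exists (fun=> 0) => [|e]; first exact: elementary_const.
  rewrite (_ : (fun s => _) = cst (e y)); first exact: is_derive_cst.
  by apply/funext => s; rewrite /set_coord (negbTE yx).
- exists (fun=> 0) => [|e]; first exact: elementary_const.
  exact: is_derive_cst.
- exists (fun e => derive1 f (F e) * G e) => [|e].
    by apply: elementary_mul => //; apply: elementary_comp => //;
       apply: smooth_derive1.
  apply: (@is_derive1_comp _ f (fun s => F (set_coord e x s))) => //.
  by rewrite set_coord_id derive1E; apply: derivableP; apply: (sf 0%N).
- exists (fun e => G1 e + G2 e) => [|e]; first exact: elementary_add.
  exact: (is_deriveD (d1 e) (d2 e)).
- exists (fun e => F1 e * G2 e + F2 e * G1 e) => [|e].
    by apply: elementary_add; apply: elementary_mul.
  by apply: is_derive_eq (is_deriveM (d1 e) (d2 e)) _; rewrite set_coord_id.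
Qed.

Lemma elementary_smooth F (e : V -> R) (x : V) :
  elementary F -> smooth (fun s => F (set_coord e x s)).
Proof.
(* Taken at the shifted point [set_coord e x s], the hypothesis gives the derivative along the line
   at any [s]. *)
have derF F1 G :
    (forall e, is_derive (e x) 1 (fun s => F1 (set_coord e x s)) (G e)) ->
    forall s : R, is_derive s 1 (fun t => F1 (set_coord e x t))
                (G (set_coord e x s)).
  move=> dF s; have := dF (set_coord e x s).
  under eq_fun => t do rewrite set_coord_twice.
  by rewrite {1}/set_coord eqxx.
move=> eF n; elim: n F eF => [|n IH] F eF s.
  by have [G _ /derF/(_ s)[]] := elementary_partial x eF.
have [G eG /derF dF] := elementary_partial x eF.
rewrite derive1Sn (_ : derive1 _ = fun s => G (set_coord e x s)).
  exact: IH.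
by apply/funext => t; have dFt := dF t; rewrite derive1E derive_val.
Qed.

End ElementaryFunctions.

Section Semantics.
Variables (R : realType) (B : finType) (S : signature).
Implicit Types (I : interp R B S) (w v : state R B) (t : trm B S).

Definition set_dot I (d : R) : interp R B S :=
  {| ifun0 := fun f => if f == dot S then d else ifun0 I f;
     ifun1 := ifun1 I;
     ifun1_smooth := @ifun1_smooth _ _ _ I;
     ipred0 := ipred0 I;
     ipred1 := ipred1 I;
     igame := igame I;
     igame_mono := @igame_mono _ _ _ I |}.

(** The extra coordinate [None] carries the value of the placeholder, so smoothness in it is
    smoothness in one coordinate. *)
Definition state_dot w (d : R) : option (var B) -> R :=
  fun o => if o is Some x then w x else d.

Lemma set_coord_state w d x s :
  set_coord (state_dot w d) (Some x) s = state_dot (upd w x s) d.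
Proof. by apply/funext => -[y|]. Qed.

Lemma set_coord_dot w d s :
  set_coord (state_dot w d) None s = state_dot w s.
Proof. by apply/funext => -[y|]. Qed.

Lemma tval_elementary I t :
  exists2 F, elementary F &
    forall w d, tval (set_dot I d) w t = F (state_dot w d).
Proof.
elim: t => [x|f|f t [F eF tF]|t [F eF tF] u [G eG uG]
           |t [F eF tF] u [G eG uG]|t [F eF tF]].
- by exists (fun e => e (Some x)) => //; apply: elementary_proj.
- rewrite /=; case: eqP => _.
    by exists (fun e => e None) => //; apply: elementary_proj.
  by exists (fun=> ifun0 I f) => //; apply: elementary_const.
- exists (fun e => ifun1 I f (F e)) => [|w d /=]; last by rewrite tF.
  by apply: elementary_comp => //; apply: ifun1_smooth.
- exists (fun e => F e + G e) => [|w d /=]; last by rewrite tF uG.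
  exact: elementary_add.
- exists (fun e => F e * G e) => [|w d /=]; last by rewrite tF uG.
  exact: elementary_mul.
- have /choice[G dF] (x : B) : exists G, elementary G /\
      forall e : option (var B) -> R,
      is_derive (e (Some (inl x))) 1
        (fun s => F (set_coord e (Some (inl x)) s)) (G e).
    by have [G eG dF] := elementary_partial (Some (inl x)) eF; exists G.
  exists (fun e => \sum_(x : B) e (Some (inr x)) * G x e).
    apply: elementary_sum => x; apply: elementary_mul; last by have [] := dF x.
    exact: elementary_proj.
  move=> w d /=; apply: eq_bigr => x _; congr (_ * _).
  have [_ /(_ (state_dot w d)) dFx] := dF x.
  rewrite -[RHS](@derive_val _ _ _ _ _ _ _ dFx) -derive1E; congr (derive1 _ _).
  by apply/funext => s; rewrite tF set_coord_state.
Qed.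

Lemma tval_dot_smooth I w t : smooth (fun d => tval (set_dot I d) w t).
Proof.
have [F eF tF] := tval_elementary I t.
have := @elementary_smooth _ _ F (state_dot w 0) None eF.
by under eq_fun => d do rewrite set_coord_dot -tF.
Qed.

(** * Static semantics *)

Definition agree_off (U : set (var B)) w v := forall y, ~ U y -> w y = v y.

Lemma agree_off_trans U w1 w2 w3 :
  agree_off U w1 w2 -> agree_off U w2 w3 -> agree_off U w1 w3.
Proof. by move=> h1 h2 y Uy; rewrite h1 // h2. Qed.

Lemma agree_off_sub U W w v : U `<=` W -> agree_off U w v -> agree_off W w v.
Proof. by move=> UW h y Wy; apply: h => /UW. Qed.

(* Finitely many variables: change them one at a time. *)
Lemma eq_agree_off (T : Type) (F : state R B -> T) (U : set (var B)) w v :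
  (forall x w1 w2, U x -> agree_except x w1 w2 -> F w1 = F w2) ->
  agree_off U w v -> F w = F v.
Proof.
move=> FU wv.
pose h (r : seq (var B)) : state R B := fun y => if y \in r then v y else w y.
have Fh r : F w = F (h r).
  elim: r => [//|x r ->]; have [Ux|nUx] := pselect (U x).
    apply: (FU x) => // y yx; rewrite /h inE.
    by have /eqP/negbTE -> := yx.
  congr F; apply/funext => y; rewrite /h inE.
  by have [->|//] := eqVneq y x; case: ifP => //= _; rewrite wv.
rewrite (Fh (enum (var B : finType))); congr F; apply/funext => y.
by rewrite /h mem_enum.
Qed.

Lemma FVt_coincidence I t (U : set (var B)) w v :
  FVt R t `&` U = set0 -> agree_off U w v -> tval I w t = tval I v t.
Proof.
move=> FU; apply: (@eq_agree_off _ (tval I ^~ t)) => x w1 w2 Ux wx.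
apply: contrapT => ne; suff : (FVt R t `&` U) x by rewrite FU.
by split => //; exists I, w1, w2.
Qed.

Lemma FVf_coincidence I (phi : fml B S) (U : set (var B)) w v :
  FVf R phi `&` U = set0 -> agree_off U w v -> fsem I phi w = fsem I phi v.
Proof.
move=> FU; apply: (@eq_agree_off _ (fsem I phi)) => x w1 w2 Ux wx.
have nFx : ~ FVf R phi x by move=> Fx; suff : (FVf R phi `&` U) x by rewrite FU.
rewrite propeqE; split => h; apply: contrapT => nh; apply: nFx.
  by exists I, w1, w2.
by exists I, w2, w1; split => // y yx; rewrite wx.
Qed.

Lemma gsem_mono I (al : game B S) (X Y : set (state R B)) :
  X `<=` Y -> gsem I al X `<=` gsem I al Y.
Proof.
elim: al X Y => [a|x t|n x injx th psi|f|a IHa b IHb|a IHa b IHb|a IHa|a IHa]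
  X Y XY /=.
- exact: igame_mono.
- by move=> w /XY.
- by move=> w [r [flow [r0 f0 /XY fr fz]]]; exists r, flow.
- by move=> w [fw /XY].
- by move=> w [/IHa|/IHb] h; [left|right]; apply: h.
- by apply: IHa; apply: IHb.
- by move=> w h Z YZ; apply: h => v [Xv|aZ]; apply: YZ; [left; apply: XY|right].
- by move=> w h /(IHa _ (~` X)) h'; apply/h/h' => v + /XY.
Qed.

(** [BV] speaks of one variable at a time. The variables outside it are frozen one by one, with the
    target restricted so far as the set [X] of the definition. *)
Lemma BV_bound I (al : game B S) (X : set (state R B)) w :
  gsem I al X w -> gsem I al (X `&` [set v | agree_off (BV R al) w v]) w.
Proof.
move=> Xw; suff h (r : seq (var B)) : gsem I al
    (X `&` [set v | forall y, y \in r -> ~ BV R al y -> w y = v y]) w.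
  apply: gsem_mono (h (enum (var B : finType))) => v [Xv wv].
  by split => // y; apply: wv; rewrite mem_enum.
elim: r => [|x r IH]; first by apply: gsem_mono Xw.
have [Bx|nBx] := pselect (BV R al x).
  apply: gsem_mono IH => v [Xv wv]; split => // y.
  by rewrite inE => /predU1P[->//|]; apply: wv.
apply: contrapT => h; apply: nBx; exists I, w.
eexists; split; first exact: IH.
apply: contra_not h; apply: gsem_mono => v [[Xv wv] vx]; split => // y.
by rewrite inE => /predU1P[->//|]; apply: wv.
Qed.

(** Confinement to the output taboo set allows whatever follows the game to be read from the same
    base state. The inclusion of the taboo sets makes consecutive confinements compose. *)
Lemma usubst_game_taboo s (U V : set (var B)) (al al' : game B S) :
  usubst_game R s U V al al' ->
  U `<=` V /\ forall I (X : set (state R B)) w,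
    gsem I al' X w -> gsem I al' (X `&` [set v | agree_off V w v]) w.
Proof.
elim=> {s U V al al'} [s U a|s U x t t' _|s U n x injx th th' psi psi' _ _
  |s U f f' _|s U V W a a' b b' _ [UV IHa] _ [UW IHb]
  |s U V W a a' b b' _ [UV IHa] _ [VW IHb]
  |s U V a a1 a' _ [UV _] _ [_ IH]|s U V a a' _ [UV IH]].
- split=> [|I X w /BV_bound]; first exact: subsetUl.
  apply: gsem_mono => v [Xv]; split => //.
  by apply: agree_off_sub; [exact: subsetUr|].
- split=> [|I X w /= Xw]; first exact: subsetUl.
  split => // y Uy; rewrite /upd; case: eqP => // yx.
  by case: Uy; right.
- split=> [|I X w /=]; first exact: subsetUl.
  move=> [r [flow [r0 f0 fr fz]]]; exists r, flow.
  split => //; split => // y Uy.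
  have nx : ~ ode_vars x y by move=> xy; apply: Uy; right.
  have [|_ _ -> // _] := fz r; first by rewrite r0 lexx.
  by rewrite f0 // => i yx; apply: nx; exists i; right.
- by split => // I X w /= [fw Xw].
- split=> [|I X w /=]; first by move=> x /UV; left.
  move=> [/IHa|/IHb] h; [left|right]; apply: gsem_mono h => v [Xv wv];
    split => //; apply: agree_off_sub wv; [exact: subsetUl|exact: subsetUr].
- split=> [|I X w /= /IHa]; first exact: subset_trans VW.
  apply: gsem_mono => v [/IHb bv wv]; apply: gsem_mono bv => u [Xu vu].
  split => //; apply: agree_off_trans vu; exact: agree_off_sub wv.
- split => // I X w /= h Z XZ.
  (* By the induction hypothesis, this enlargement of [Z] is still closed under a round of the loop,
     now for the unrestricted target [X]. *)
  suff : [set v | agree_off V w v -> Z v] w by apply.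
  apply: h => v [Xv wv|/IH av wv]; first by apply: XZ; left.
  apply: XZ; right; apply: gsem_mono av => u [Zu vu].
  exact/Zu/agree_off_trans/vu.
- split => // I X w /= h /IH h'; apply: h; apply: gsem_mono h' => v [nX wv] Xv.
  exact: nX.
Qed.

(** * Adjoint interpretations *)

Lemma interp_ext I J :
  ifun0 I =1 ifun0 J -> (forall f, ifun1 I f =1 ifun1 J f) ->
  (forall p, ipred0 I p = ipred0 J p) -> (forall p, ipred1 I p = ipred1 J p) ->
  (forall a, igame I a = igame J a) -> I = J.
Proof.
case: I => i0 i1 s1 p0 p1 g m; case: J => j0 j1 t1 q0 q1 h k /=.
move=> /funext e0 e1 /funext ep0 /funext ep1 /funext eg.
have {}e1 : i1 = j1 by apply/funext => f; apply/funext/e1.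
by subst; rewrite (Prop_irrelevance s1 t1) (Prop_irrelevance m k).
Qed.

Variable s : usubst B S.

Definition adj_fun1 I w (f : fun1 S) : R -> R :=
  if (sfun1 s).[? f]%fmap is Some rep then fun d => tval (set_dot I d) w rep
  else ifun1 I f.

Lemma adj_fun1_smooth I w f : smooth (adj_fun1 I w f).
Proof.
rewrite /adj_fun1; case: fnd => [rep|]; first exact: tval_dot_smooth.
exact: ifun1_smooth.
Qed.

Definition adj_pred1 I w (p : pred1 S) : set R :=
  if (spred1 s).[? p]%fmap is Some rep
  then [set d | fsem (set_dot I d) rep w]
  else ipred1 I p.

(** Game symbols ignore [w]: a replacement game is read in the state where it is played. *)
Definition adjoint I w : interp R B S :=
  {| ifun0 := fun f => tval I w (apply_fun0 s f);
     ifun1 := adj_fun1 I w;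
     ifun1_smooth := @adj_fun1_smooth I w;
     ipred0 := fun p => fsem I (apply_pred0 s p) w;
     ipred1 := adj_pred1 I w;
     igame := fun a => gsem I (apply_game s a);
     igame_mono := fun a => @gsem_mono I (apply_game s a) |}.

End Semantics.

(** * Substituted syntax against the adjoint reading *)

Section Substitution.
Variables (R : realType) (B : finType) (S : signature).
Implicit Types (I : interp R B S) (w v : state R B) (t : trm B S).
Implicit Types (s : usubst B S) (U V : set (var B)).

Lemma adjoint_dot_subst I w t :
  adjoint (dot_subst t) I w = set_dot I (tval I w t).
Proof.
apply: interp_ext => [f|f d|p|p|a] /=.
- by rewrite /apply_fun0 /= fnd_set fnd_fmap0; case: eqP.
- by rewrite /adj_fun1 /= fnd_fmap0.
- by rewrite /apply_pred0 /= fnd_fmap0.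
- by rewrite /adj_pred1 /= fnd_fmap0.
- by rewrite /apply_game /= fnd_fmap0.
Qed.

Lemma usubst_trm_adjoint s U t t' : usubst_trm R s U t t' ->
  forall I w v, agree_off U w v -> tval I v t' = tval (adjoint s I w) v t.
Proof.
elim=> {s U t t'} [s U x|s U f FU|s U f t t' rep res e FU _ IHt _ IHrep
  |s U f t t' e _ IH|s U t t' u u' _ IHt _ IHu|s U t t' u u' _ IHt _ IHu
  |s U t t' _ IH] I w v wv //=.
- by rewrite (FVt_coincidence _ FU wv).
(* The inner substitution has empty taboo set, so its base state is [v] itself; the side condition
   then moves the replacement from [v] to [w]. *)
- rewrite (IHrep I v v) // adjoint_dot_subst /adj_fun1 e -(IHt I w v) //.
  by rewrite (FVt_coincidence _ FU wv).
- by rewrite /adj_fun1 e -(IH I w v).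
- by rewrite -(IHt I w v) // -(IHu I w v).
- by rewrite -(IHt I w v) // -(IHu I w v).
(* Under taboo set [setT] the hypothesis holds in every state, so the differentiated functions are
   equal, not just their values at [v]. *)
- apply: eq_bigr => x _; congr (_ * _).
  congr (derive1 _ _).
  by apply/funext => r; apply: IH => y [].
Qed.

(** The flow, including the initial jump of the differential variables, leaves [v] only on
    [ode_vars x]. *)
Lemma ode_region_congr (n : nat) (x : 'I_n.+1 -> B)
    (th th' : 'I_n.+1 -> state R B -> R) (dom dom' X : set (state R B)) v :
  (forall u, agree_off (ode_vars x) v u ->
     (forall i, th i u = th' i u) /\ (dom u -> dom' u)) ->
  ode_region x th dom X v -> ode_region x th' dom' X v.
Proof.
move=> h [r [flow [r0 f0 fr fz]]]; exists r, flow; split => // z zr.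
have [dz tz ez Dz] := fz z zr.
have [|et ed] := h (flow z).
  move=> y ny; rewrite ez // f0 // => i yx.
  by apply: ny; exists i; right.
by split => // [|i]; [exact: ed|rewrite tz et].
Qed.

(* Two games that agree on a class [E] of states to which the first one confines
   its moves have the same least fixpoints on [E]. *)
Lemma star_congr (E : set (state R B))
    (F G : set (state R B) -> set (state R B)) (X : set (state R B)) :
  (forall Y Z, Y `<=` Z -> F Y `<=` F Z) ->
  (forall Y v, E v -> F Y v -> F (Y `&` E) v) ->
  (forall Y v, E v -> F Y v <-> G Y v) ->
  forall v, E v ->
    (\bigcap_(Z in [set Z | X `|` F Z `<=` Z]) Z) v <->
    (\bigcap_(Z in [set Z | X `|` G Z `<=` Z]) Z) v.
Proof.
move=> mF EF FG v Ev.
(* Confinement to [E] lets a target that is only required on [E] stand in for [Y]. *)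
have relax Y u : E u -> F [set u' | E u' -> Y u'] u -> F Y u.
  by move=> Eu /(EF _ _ Eu); apply: mF => u' [h /h].
split=> h Z XZ; suff : [set u | E u -> Z u] v by apply.
- apply: h => u [Xu _|Fu Eu]; first by apply: XZ; left.
  by apply: XZ; right; apply/FG => //; apply: relax.
- apply: h => u [Xu _|Gu Eu]; first by apply: XZ; left.
  by apply: XZ; right; apply: relax => //; apply/FG.
Qed.

Lemma usubst_fml_adjoint s U (phi phi' : fml B S) : usubst_fml R s U phi phi' ->
  forall I w v, agree_off U w v ->
    fsem I phi' v <-> fsem (adjoint s I w) phi v.
Proof.
apply: (@usubst_fml_game_ind R B S
  (fun s U phi phi' _ => forall I w v, agree_off U w v ->
    fsem I phi' v <-> fsem (adjoint s I w) phi v)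
  (fun s U V al al' _ => forall I w v X, agree_off U w v ->
    gsem I al' X v <-> gsem (adjoint s I w) al X v)) => {s U phi phi'}.
- move=> s U t t' u u' ht hu I w v wv /=.
  by rewrite (usubst_trm_adjoint ht I wv) (usubst_trm_adjoint hu I wv).
- by move=> s U p FU I w v wv /=; rewrite (FVf_coincidence _ FU wv).
- move=> s U p t t' rep res e FU ht _ IH I w v wv /=.
  rewrite (IH I v v) // adjoint_dot_subst /adj_pred1 e.
  by rewrite (usubst_trm_adjoint ht I wv) /= (FVf_coincidence _ FU wv).
- move=> s U p t t' e ht I w v wv /=.
  by rewrite /adj_pred1 e (usubst_trm_adjoint ht I wv).
- by move=> s U f f' _ IH I w v wv /=; have := IH I w v wv; tauto.
- move=> s U f f' g g' _ IHf _ IHg I w v wv /=.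
  by have := IHf I w v wv; have := IHg I w v wv; rewrite /setI /=; tauto.
- move=> s U x f f' _ IH I w v wv /=.
  have E r : agree_off (U `|` [set x]) w (upd v x r).
    move=> y ny; rewrite /upd; case: eqP => [yx|_]; first by case: ny; right.
    by apply: wv => Uy; apply: ny; left.
  by split=> -[r fr]; exists r; apply/(IH I w) => //; apply: E.
- move=> s U V a a' f f' ha IHa _ IHf I w v wv /=.
  have [UV bd] := usubst_game_taboo ha.
  have E u : agree_off V v u -> agree_off V w u.
    exact/agree_off_trans/agree_off_sub/wv.
  (* With the substituted game on both sides, [bd] confines either target to states where the
     hypothesis on the postcondition applies. *)
  rewrite -(IHa I w v _ wv); split=> /bd; apply: gsem_mono => u [fu /E vu];
    exact/(IHf I w u vu).
- by [].
- by move=> s U x t t' ht I w v X wv /=; rewrite (usubst_trm_adjoint ht I wv).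
- move=> s U n x injx th th' psi psi' hth _ IH I w v X wv /=.
  have E u : agree_off (ode_vars x) v u -> agree_off (U `|` ode_vars x) w u.
    move=> vu y ny; rewrite wv; last by move=> Uy; apply: ny; left.
    by apply: vu => xy; apply: ny; right.
  split; apply: ode_region_congr => u /E wu; split=> [i|].
  + exact: usubst_trm_adjoint (hth i) _ _ _ wu.
  + by move/(IH I w u wu).
  + by rewrite -(usubst_trm_adjoint (hth i) I wu).
  + by move/(IH I w u wu).
- by move=> s U f f' _ IH I w v X wv /=; rewrite /setI /= (IH I w v wv).
- move=> s U V W a a' b b' _ IHa _ IHb I w v X wv /=.
  by rewrite /setU /= (IHa I w v X wv) (IHb I w v X wv).
- move=> s U V W a a' b b' ha IHa _ IHb I w v X wv /=.
  have [UV bd] := usubst_game_taboo ha.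
  have E u : agree_off V v u -> agree_off V w u.
    exact/agree_off_trans/agree_off_sub/wv.
  rewrite -(IHa I w v _ wv); split=> /bd; apply: gsem_mono => u [bu /E vu];
    exact/(IHb I w u X vu).
- move=> s U V a a1 a' ha _ ha' IH I w v X wv /=.
  have [UV _] := usubst_game_taboo ha; have [_ bd] := usubst_game_taboo ha'.
  (* All rounds share the base state [w]: the substitution from [V] to [V] is correct in each state
     that agrees with [w] off [V]. *)
  apply: (@star_congr [set u | agree_off V w u]).
  + exact: gsem_mono.
  + move=> Y u wu /bd; apply: gsem_mono => u' [Yu' uu']; split => //.
    exact: agree_off_trans uu'.
  + by move=> Y u wu; apply: IH.
  + exact: agree_off_sub wv.
- move=> s U V a a' _ IH I w v X wv /=.
  by rewrite /setC /=; have := IH I w v (~` X) wv; rewrite /setC; tauto.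
Qed.

End Substitution.

(** * Transfer of local soundness *)

Theorem theorem19 (R : realType) (B : finType) (S : signature) (n : nat)
    (phi phi' : 'I_n -> fml B S) (psi psi' : fml B S) (sigma : usubst B S) :
  locally_sound R phi psi ->
  (forall j, usubst_fml R sigma setT (phi j) (phi' j)) ->
  usubst_fml R sigma setT psi psi' ->
  locally_sound R phi' psi'.
Proof.
move=> sound hphi hpsi I valid'.
(* With all variables taboo, any base state would do; the zero state is an arbitrary choice. *)
have E (v : state R B) : agree_off setT (fun=> 0) v by move=> y [].
have valid_adj chi chi' : usubst_fml R sigma setT chi chi' ->
    valid_in I chi' <-> valid_in (adjoint sigma I (fun=> 0)) chi.
  move=> h; rewrite /valid_in -!subTset.
  by split=> val v _; apply/(usubst_fml_adjoint h I (E v)); apply: val.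
apply/(valid_adj _ _ hpsi); apply: sound => j.
by apply/(valid_adj _ _ (hphi j)).
Qed.
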